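(* Let $U$ be a set, $\mathcal Y\subseteq\mathcal P(U)$ a family of subsets of $U$, and let $\eta,\rho:\mathcal Y\to\mathcal P(U)$ be functions. Then there is an attacking level 2 structure relative to $\eta$ representing $\rho$ if and only if both of the following hold: (1) $\rho(X)\subseteq\eta(X)$ for all $X\in\mathcal Y$; (2) $\rho(\emptyset)=\eta(\emptyset)$ if $\emptyset\in\mathcal Y$.
   Context: $\mathcal P$ is the power set operator. A generalized preferential structure $\mathcal X$ over a set $U$ consists of a set of points, which are pairs $\langle x,i\rangle$ (''copies'' of $x$) with $x\in U$ and $i$ an index, and a set of arrows. Each arrow $\alpha$ has an origin, which is a point, and a destination, which is a point or another arrow; distinct arrows may have the same origin and destination (copies of arrows). Here every $x\in U$ has at least one copy. We write $\alpha:\langle x,i\rangle\to d$, or just $\alpha:x\to d$, when the origin is a copy of $x$ and the destination is $d$. Levels: an arrow whose destination is a point has level 1; an arrow whose destination is an arrow of level $n$ has level $n+1$. $\mathcal X$ is a level $n$ structure ($n\ge 1$ finite) iff every arrow has level at most $n$. For arrows define inductively: if $\alpha:\langle x,i\rangle\to\langle y,j\rangle$ has level 1, $O(\alpha)=\{x\}$ and $D(\alpha)=\{y\}$; if $\alpha:\langle x,i\rangle\to\beta$ with $\beta$ an arrow, $O(\alpha)=\{x\}\cup O(\beta)$ and $D(\alpha)=D(\beta)$. Validity (by downward induction on the level): for sets $X,Y\subseteq U$, an arrow $\alpha$ is a valid $X$-to-$Y$ arrow iff $O(\alpha)\subseteq X$, $D(\alpha)\subseteq Y$, and for every arrow $\beta:x'\to\alpha$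 with $x'\in X$ there is an arrow $\gamma:x''\to\beta$ which is a valid $X$-to-$Y$ arrow. $\mathcal X$ is called an attacking structure relative to $\eta$ representing $\rho$ iff for all $X\in\mathcal Y$: $\rho(X)$ is the set of all $x\in\eta(X)$ such that there is a copy $\langle x,i\rangle$ in $\mathcal X$ for which there is no valid $X$-to-$\eta(X)$ arrow $\alpha:\langle x',i'\rangle\to\langle x,i\rangle$. An ''attacking level 2 structure'' is an attacking structure which is a level 2 structure. *)

(* Defs.v *)
From mathcomp Require Import all_boot boolp classical_sets.

Set Implicit Arguments.
Unset Strict Implicit.
Unset Printing Implicit Defensive.

Local Open Scope classical_set_scope.

(* Arrows form a type of their own, so that distinct arrows may share origin
   and destination. *)
Record gpstruct (U : Type) := GPStruct {
  index : Type;
  points : set (U * index);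
  arrow : Type;
  origin : arrow -> points;
  destination : arrow -> points + arrow;
  has_copy : forall x : U, exists i : index, points (x, i);
  destination_other : forall a : arrow, destination a <> inr a
}.

Arguments points {U} g _.

Section Structure.
Variables (U : Type) (S : gpstruct U).

Definition base (p : points S) : U := (val p).1.

Definition source (a : arrow S) : U := base (origin a).

(* An arrow on an infinite or cyclic chain of destinations has no level. *)
Inductive level : arrow S -> nat -> Prop :=
| level_point a p : destination a = inl p -> level a 1
| level_arrow a b n : destination a = inr b -> level b n -> level a n.+1.

Definition level_structure (n : nat) : Prop :=
  forall a : arrow S, exists2 m, level a m & m <= n.

Inductive O : arrow S -> set U :=
| O_source a : O a (source a)
| O_arrow a b x : destination a = inr b -> O b x -> O a x.

Inductive D : arrow S -> set U :=
| D_point a p : destination a = inl p -> D a (base p)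
| D_arrow a b y : destination a = inr b -> D b y -> D a y.

(* The validity of [a] refers only to that of arrows [c] two levels higher: in
   a structure of finite level, this inductive predicate is the unique solution
   of the defining equivalence, i.e., the downward recursion on the level. *)
Inductive valid (X Y : set U) (a : arrow S) : Prop :=
| Valid of O a `<=` X & D a `<=` Y &
    (forall b, destination b = inr a -> X (source b) ->
       exists2 c, destination c = inr b & valid X Y c).

Definition attacking (YY : set (set U)) (eta rho : YY -> set U) : Prop :=
  forall X : YY,
    rho X = [set x | eta X x /\
      exists2 p : points S, base p = x &
        ~ exists2 a, destination a = inl p & valid (val X) (eta X) a].

End Structure.

(* Main.v *)
Require Import Defs.
From mathcomp Require Import all_boot boolp classical_sets.

Local Open Scope classical_set_scope.

(** A level 2 structure has no arrow attacking a level 2 arrow, so a level 1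
    arrow to a copy of [x] is valid for [X] iff it starts in [X], [x] lies in
    [eta X], and none of its attackers starts in [X].  Give [x] one copy
    [(x, Z)] for each [Z] with [x] in [rho Z], and attack it validly for every
    nonempty [X <> Z] but not for [Z]: from each [y] in [X], provided that
    [y] is outside [Z] or [Z] is not included in [X], draw an arrow, itself
    attacked from every point outside [X].  The empty set has no valid arrows
    at all; this is condition (2), and it makes the copy [(x, set0)] harmless,
    so that [x] has a copy even if it lies in no [rho Z]. *)

Lemma O_eq_source {U} {S : gpstruct U} {a : arrow S} {p} :
  destination a = inl p -> O a = [set source a].
Proof.
move=> ap; apply/seteqP; split=> x; last by move=> ->; exact: O_source.
by move=> Oax; case: Oax ap => // {}a b {}x -> _.
Qed.

Lemma D_eq_point {U} {S : gpstruct U} {a : arrow S} {p} :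
  destination a = inl p -> D a = [set base p].
Proof.
move=> ap; apply/seteqP; split=> x; last by move=> ->; exact: D_point.
by move=> Dax; case: Dax ap => [{}a q -> [->]|{}a b {}x ->].
Qed.

Lemma valid_set0 {U} {S : gpstruct U} {Y} {a : arrow S} : ~ valid set0 Y a.
Proof. by case=> Oa _ _; exact: Oa (O_source a). Qed.

Section Construction.
Context {U : Type} {YY : set (set U)} (rho : YY -> set U).

Definition copies : set (U * set U) :=
  [set p | p.2 = set0 \/ exists2 Z : YY, val Z = p.2 & rho Z p.1].

Lemma copies_set0 x : copies (x, set0).
Proof. by left. Qed.

Definition copy {x Z} (xZ : copies (x, Z)) : copies := 
  exist _ (x, Z) (mem_set xZ).

(** Only sets between [start] and [aim], that is, subsets of [aim] containing [start], can make the
    attack valid; [avoid_index] keeps the index of the target from being one. *)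
Record attack := Attack {
  target : copies;
  start : U;
  aim : set U;
  aim_start : aim start;
  avoid_index : (val target).2 start -> ~ (val target).2 `<=` aim
}.

(* [inr (a, z)] stands for an arrow from [z] to the arrow [inl a]. *)
Definition rho_arrow : Type := attack + {az : attack * U | ~ aim az.1 az.2}.

Definition rho_origin (a : rho_arrow) : copies :=
  match a with
  | inl a => copy (copies_set0 (start a))
  | inr b => copy (copies_set0 (sval b).2)
  end.

Definition rho_destination (a : rho_arrow) : copies + rho_arrow :=
  match a with
  | inl a => inl (target a)
  | inr b => inr (inl (sval b).1)
  end.

Lemma rho_has_copy x : exists Z, copies (x, Z).
Proof. by exists set0; exact: copies_set0. Qed.

Lemma rho_destination_other a : rho_destination a <> inr a.
Proof. by case: a. Qed.

Definition rho_struct : gpstruct U :=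
  @GPStruct U (set U) copies rho_arrow rho_origin rho_destination
    rho_has_copy rho_destination_other.

Lemma rho_struct_level : level_structure rho_struct 2.
Proof.
have level1 (a : attack) : @level U rho_struct (inl a) 1.
  exact: (@level_point U rho_struct (inl a) (target a)).
case=> [a|b]; first by exists 1.
exists 2 => //; apply: level_arrow (level1 (sval b).1).
by [].
Qed.

Lemma valid_attack (X Y : set U) (a : attack) :
  @valid U rho_struct X Y (inl a) <->
  [/\ X (start a), Y (val (target a)).1 & X `<=` aim a].
Proof.
have aE : @destination U rho_struct (inl a) = inl (target a) by [].
split=> [[Oa Da att]|[Xa Ya Xaim]].
- split.
  + exact: Oa (O_source _).
  + by apply: Da; rewrite (D_eq_point aE).
  + move=> z Xz; apply: contrapT => naz.
    (* No arrow attacks a level 2 arrow, so this attacker goes unanswered. *)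
    by have [[]] := att (inr (exist _ (a, z) naz)) erefl Xz.
- split; first by rewrite (O_eq_source aE) => _ ->.
  + by rewrite (D_eq_point aE) => _ ->.
  + move=> [//|[[a' z] /= naz]] [a'a] Xz; subst a'.
    by case: (naz); exact: Xaim.
Qed.

Lemma rho_struct_attacking (eta : YY -> set U) :
  (forall X : YY, rho X `<=` eta X) ->
  (forall X : YY, val X = set0 -> rho X = eta X) ->
  attacking rho_struct eta rho.
Proof.
move=> rho_eta rho0 X; apply/seteqP; split=> x.
- move=> rhox; split; first exact: rho_eta.
  have xX : copies (x, val X) by right; exists X.
  exists (copy xX) => // -[[a|//] [aX]] /valid_attack[Xa _ Xaim].
  by have := @avoid_index a; rewrite aX; apply.
- move=> [etax [p px noatt]]; subst x; apply: contrapT => nrho.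
  have XZ : (val p).2 <> val X.
    (* An index [set0] would make [val X] empty; an index [val Z] would give [Z = X]. *)
    move=> pX; have [p0|[Z Zp rhoZ]] := set_mem (valP p).
      by apply: nrho; rewrite rho0 // -pX.
    by apply: nrho; rewrite (_ : X = Z) //; apply: val_inj; rewrite Zp.
  (* A point of [val X] outside the index works; if there is none, [val X] is a proper subset of the
     index and any of its points works. *)
  have [y Xy Zy] : exists2 y, val X y & (val p).2 y -> ~ (val p).2 `<=` val X.
    have [XsubZ|] := pselect (val X `<=` (val p).2); last first.
      by move=> /existsNP[y /not_implyP[Xy nZy]]; exists y.
    have [X0|/set0P[y Xy]] := eqVneq (val X) set0.
      by case: nrho; rewrite rho0.
    by exists y => // _ ZsubX; apply: XZ; apply/seteqP.
  apply: noatt; exists (inl (Attack p y (val X) Xy Zy)) => //.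
  by apply/valid_attack; split.
Qed.

End Construction.

Theorem proposition3p7 (U : Type) (YY : set (set U)) (eta rho : YY -> set U) :
  (exists S : gpstruct U, level_structure S 2 /\ attacking S eta rho) <->
  (forall X : YY, rho X `<=` eta X) /\
  (forall X : YY, val X = set0 -> rho X = eta X).
Proof.
split=> [[S [_ att]]|[rho_eta rho0]].
- split=> X; first by rewrite att => x [].
  move=> X0; rewrite att; apply/seteqP; split=> x; first by case.
  (* Any copy will do, as no arrow is valid from the empty set. *)
  move=> etax; split=> //; have [i xi] := has_copy S x.
  exists (exist _ (x, i) (mem_set xi)) => // -[a _].
  by rewrite X0; exact: valid_set0.
- exists (rho_struct rho); split; first exact: rho_struct_level.
  exact: rho_struct_attacking.
Qed.
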